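(* Let $\mathcal{A}$ be a finite alphabet. Then: (1) every path set $\mathcal{P}\subseteq\mathcal{A}^{\mathbb{N}}$ is a closed subset of $\mathcal{A}^{\mathbb{N}}$, where $\mathcal{A}^{\mathbb{N}}$ carries the product topology; (2) if $\mathcal{P}_1,\mathcal{P}_2\subseteq\mathcal{A}^{\mathbb{N}}$ are path sets, then $\mathcal{P}_1\cap\mathcal{P}_2$ is a path set (on the alphabet $\mathcal{A}$); (3) if $\mathcal{P}_1,\mathcal{P}_2\subseteq\mathcal{A}^{\mathbb{N}}$ are path sets, then $\mathcal{P}_1\cup\mathcal{P}_2$ is a path set (on the alphabet $\mathcal{A}$).
   Context: $\mathcal{A}$ is a finite alphabet (discrete topology), and $\mathcal{A}^{\mathbb{N}}$ is the set of one-sided infinite sequences $a_0a_1a_2\cdots$ with $a_i\in\mathcal{A}$. A labeled directed graph over $\mathcal{A}$ is a finite directed graph $\mathcal{G}$ with vertex set $V$ whose edges carry labels from $\mathcal{A}$; loops and multiple edges are allowed, but the triples (initial vertex, terminal vertex, label) are required to be distinct. A pointed graph $(\mathcal{G},v)$ is such a graph with a distinguished vertex $v$. The path set $X_{\mathcal{G}}(v)\subseteq\mathcal{A}^{\mathbb{N}}$ is the set of all sequences of successive edge labels of one-sided infinite walks in $\mathcal{G}$ starting at $v$ (it is empty if there are no such walks). A subset of $\mathcal{A}^{\mathbb{N}}$ is called a path set if it equals $X_{\mathcal{G}}(v)$ for some pointed graph $(\mathcal{G},v)$ over $\mathcal{A}$. *)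

(* Defs.v *)
From mathcomp Require Import all_boot.
From mathcomp Require Import boolp classical_sets topology function_spaces.

Set Implicit Arguments.
Unset Strict Implicit.
Unset Printing Implicit Defensive.

Local Open Scope classical_set_scope.

Notation "''Seq' ( A )" := {ptws nat -> discrete_topology A}
  (at level 8, format "''Seq' ( A )") : type_scope.

Record labeled_graph (A : finType) := LabeledGraph {
  vertex : finType;
  edge : finType;
  source : edge -> vertex;
  target : edge -> vertex;
  label : edge -> A;
  edge_triple_inj : injective (fun e => (source e, target e, label e))
}.

Definition walk_from (A : finType) (G : labeled_graph A) (v : vertex G) :
    set (nat -> edge G) :=
  [set w | source (w 0) = v /\ forall n, target (w n) = source (w n.+1)].

Definition path_set_of (A : finType) (G : labeled_graph A) (v : vertex G) :
    set 'Seq(A) :=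
  [set (fun n => label (w n)) | w in walk_from v].

Definition is_path_set (A : finType) (P : set 'Seq(A)) : Prop :=
  exists (G : labeled_graph A) (v : vertex G), P = path_set_of v.

(* Main.v *)
Require Import Defs.
From mathcomp Require Import all_boot.
From mathcomp Require Import boolp classical_sets topology function_spaces.

Set Implicit Arguments.
Unset Strict Implicit.
Unset Printing Implicit Defensive.

Local Open Scope classical_set_scope.

(** Since parallel edges carry distinct labels, a labeled graph is the same
    thing as a nondeterministic transition relation on a finite set of states.
    In that form, intersections come from product states and unions from a
    fresh initial state branching into either relation.  Closedness is Koenig's
    lemma: if every prefix of x labels a run, then, the states being finite in
    number, one can move along the letters of x through states from which
    arbitrarily long prefixes of the rest of x can still be read. *)

Definition runs (A : Type) (V : Type) (r : V -> V -> A -> bool) (v : V) :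
    set (nat -> A) :=
  [set x | exists q : nat -> V,
     q 0 = v /\ forall n, r (q n) (q n.+1) (x n)].

Section TransitionGraph.
Variables (A V : finType) (r : V -> V -> A -> bool).

(** Taking the permitted triples themselves as edges makes distinctness of (source, target, label)
    automatic. *)
Let transition := {t : V * V * A | r t.1.1 t.1.2 t.2}.

Lemma transition_triple_inj :
  injective (fun t : transition => ((val t).1.1, (val t).1.2, (val t).2)).
Proof.
by move=> [[[s1 s2] s3] s_r] [[[t1 t2] t3] t_r] /= [*]; apply: val_inj; congr (_, _, _).
Qed.

Definition transition_graph : labeled_graph A :=
  LabeledGraph transition_triple_inj.

Lemma path_set_transition_graph (v : V) :
  path_set_of (v : vertex transition_graph) = runs r v.
Proof.
apply/seteqP; split => x /=.
  case=> w [w0 w_walk] <-; exists (fun n => (val (w n)).1.1); split=> // n.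
  by have /= <- := w_walk n; exact: valP (w n).
case=> q [q0 q_run].
by exists (fun n => exist _ (q n, q n.+1, x n) (q_run n) : transition).
Qed.

End TransitionGraph.

Lemma is_path_setP (A : finType) (P : set 'Seq(A)) :
  is_path_set P <->
  exists (V : finType) (r : V -> V -> A -> bool) (v : V), P = runs r v.
Proof.
split=> [[G [v ->]]|[V [r [v ->]]]]; last first.
  by exists (transition_graph r), v; rewrite path_set_transition_graph.
pose r (s t : vertex G) a :=
  [exists e : edge G, [&& source e == s, target e == t & label e == a]].
exists (vertex G), r, v; apply/seteqP; split => x /=.
  case=> w [w0 w_walk] <-; exists (fun n => source (w n)); split=> // n.
  by apply/existsP; exists (w n); rewrite w_walk !eqxx.
case=> q [q0 q_run].
have /choice[w w_q] n : exists e : edge G,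
    [/\ source e = q n, target e = q n.+1 & label e = x n].
  by have /existsP[e /and3P[/eqP ? /eqP ? /eqP ?]] := q_run n; exists e.
exists w; first split=> [|n]; first by have [->] := w_q 0.
  by have [_ -> _] := w_q n; have [->] := w_q n.+1.
by apply/funext => n; have [] := w_q n.
Qed.

Section Koenig.
Variables (A : Type) (V : finType) (r : V -> V -> A -> bool) (x : nat -> A).

(** A finite run is a total function constrained only below [n], so that a long run also serves as a
    shorter one. *)
Let reads_long (k : nat) (v : V) : Prop :=
  forall n, exists q : nat -> V,
    q 0 = v /\ forall i, i < n -> r (q i) (q i.+1) (x (k + i)).

(** Otherwise each of the finitely many successors [u] of [v] fails at some length [N u], and a run
    from [v] exceeding all these lengths is contradicted at its second state. *)
Lemma reads_long_step k v :
  reads_long k v -> exists u, r v u (x k) /\ reads_long k.+1 u.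
Proof.
move=> v_long; apply: contrapT => /forallNP no_step.
have /choice[N stuck] u : exists n, r v u (x k) -> ~ exists q : nat -> V,
    q 0 = u /\ forall i, i < n -> r (q i) (q i.+1) (x (k.+1 + i)).
  have [vu|] := boolP (r v u (x k)); last by exists 0.
  have /existsNP[n u_stuck] : ~ reads_long k.+1 u.
    by move=> u_long; apply: (no_step u).
  by exists n.
(* One letter is spent on leaving [v]; the others cover [N (q 1)], whichever successor [q 1] is. *)
have [q [q0 q_run]] := v_long (\max_u N u).+1.
apply: (stuck (q 1)); first by rewrite -q0 -[k]addn0; exact: q_run.
exists (fun i => q i.+1); split=> // i ltiN.
rewrite addSnnS; apply: q_run; rewrite ltnS.
exact: leq_trans ltiN (leq_bigmax _).
Qed.

Lemma koenig_runs v :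
  (forall n, exists q : nat -> V,
     q 0 = v /\ forall i, i < n -> r (q i) (q i.+1) (x i)) ->
  runs r v x.
Proof.
move=> v_long.
(* Where [reads_long] fails, [v] is a mere default; iterating [f] from [v] never meets such a
   pair. *)
have /choice[f f_step] (kv : nat * V) : exists u, reads_long kv.1 kv.2 ->
    r kv.2 u (x kv.1) /\ reads_long kv.1.+1 u.
  have [/reads_long_step[u]|] := pselect (reads_long kv.1 kv.2); first by exists u.
  by exists v.
pose q n := iteri n (fun k u => f (k, u)) v.
have q_long n : reads_long n (q n).
  by elim: n => [//|n IHn]; have [] := f_step (n, q n) IHn.
by exists q; split=> // n; have [] := f_step (n, q n) (q_long n).
Qed.

End Koenig.

(** The cylinder of sequences agreeing with [x] below [n] is a neighbourhood of [x]: it is a finite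
    intersection of preimages of open singletons under the continuous projections. *)
Lemma closure_prefix (A : finType) (P : set 'Seq(A)) (x : 'Seq(A)) n :
  closure P x -> exists2 y, P y & forall i, i < n -> y i = x i.
Proof.
have near_coord (i : nat) : \forall y \near x, y i = x i.
  have : nbhs (x i : discrete_topology A) [set a | a = x i].
    by rewrite nbhs_principalE; apply/principal_filterP.
  exact: (@proj_continuous _ (fun=> discrete_topology A) i x [set a | a = x i]).
have near_prefix : \forall y \near x, forall i : 'I_n, (y : 'Seq(A)) i = x i.
  exact: (@filter_forall _ _ (fun (i : 'I_n) (y : 'Seq(A)) => y i = x i) _ _
           (fun i => near_coord i)).
move=> /(_ _ near_prefix)[y [Py y_x]].
by exists y => // i ltin; exact: (y_x (Ordinal ltin)).
Qed.

Lemma closed_path_set (A : finType) (P : set 'Seq(A)) : is_path_set P -> closed P.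
Proof.
move=> /is_path_setP[V [r [v ->]]] x clx; apply: koenig_runs => n.
have [y [q [q0 q_run]] y_x] := closure_prefix n clx.
by exists q; split=> // i /y_x <-.
Qed.

Lemma is_path_setI (A : finType) (P1 P2 : set 'Seq(A)) :
  is_path_set P1 -> is_path_set P2 -> is_path_set (P1 `&` P2).
Proof.
move=> /is_path_setP[V1 [r1 [v1 ->]]] /is_path_setP[V2 [r2 [v2 ->]]].
apply/is_path_setP; exists (V1 * V2)%type.
exists (fun s t a => r1 s.1 t.1 a && r2 s.2 t.2 a), (v1, v2).
apply/seteqP; split=> x /=.
  case=> -[q1 [q10 q1_run]] [q2 [q20 q2_run]]; exists (fun n => (q1 n, q2 n)).
  by split=> [|n]; rewrite /= ?q10 ?q20 // q1_run q2_run.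
case=> q [q0 q_run]; split.
  by exists (fun n => (q n).1); rewrite q0; split=> // n; case/andP: (q_run n).
by exists (fun n => (q n).2); rewrite q0; split=> // n; case/andP: (q_run n).
Qed.

Lemma is_path_setU (A : finType) (P1 P2 : set 'Seq(A)) :
  is_path_set P1 -> is_path_set P2 -> is_path_set (P1 `|` P2).
Proof.
move=> /is_path_setP[V1 [r1 [v1 ->]]] /is_path_setP[V2 [r2 [v2 ->]]].
apply/is_path_setP; exists (option (V1 + V2)).
(* No transition enters [None] or joins the two summands, so the first step decides for good which
   relation is followed. *)
pose r (s t : option (V1 + V2)) a :=
  match s, t with
  | None, Some (inl t1) => r1 v1 t1 a
  | None, Some (inr t2) => r2 v2 t2 a
  | Some (inl s1), Some (inl t1) => r1 s1 t1 a
  | Some (inr s2), Some (inr t2) => r2 s2 t2 a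
  | _, _ => false
  end.
exists r, None; apply/seteqP; split=> x /=.
  case=> -[q [q0 q_run]].
    exists (fun n => if n is 0 then None else Some (inl (q n))).
    by split=> // -[|n]; rewrite /= -?q0; exact: q_run.
  exists (fun n => if n is 0 then None else Some (inr (q n))).
  by split=> // -[|n]; rewrite /= -?q0; exact: q_run.
case=> q [q0 q_run]; case q1: (q 1) (q_run 0) => [[u|u]|]; rewrite q0 //= => vu.
(* The default [v1] is the value needed at time 0, where the state is [None]; at all later times the
   state lies in the left summand. *)
- left; pose p (s : option (V1 + V2)) := if s is Some (inl s1) then s1 else v1.
  have q_inl n : q n.+1 = Some (inl (p (q n.+1))).
    elim: n => [|n IHn]; first by rewrite q1.
    by have := q_run n.+1; rewrite IHn /=; case: (q n.+2) => [[]|].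
  exists (fun n => p (q n)); rewrite q0; split=> // -[|n].
    by rewrite q0 q1.
  by have := q_run n.+1; rewrite {1}q_inl (q_inl n.+1).
- right; pose p (s : option (V1 + V2)) := if s is Some (inr s2) then s2 else v2.
  have q_inr n : q n.+1 = Some (inr (p (q n.+1))).
    elim: n => [|n IHn]; first by rewrite q1.
    by have := q_run n.+1; rewrite IHn /=; case: (q n.+2) => [[]|].
  exists (fun n => p (q n)); rewrite q0; split=> // -[|n].
    by rewrite q0 q1.
  by have := q_run n.+1; rewrite {1}q_inr (q_inr n.+1).
Qed.

Theorem theorem1p2 (A : finType) :
  (forall P : set 'Seq(A), is_path_set P -> closed P) /\
  (forall P1 P2 : set 'Seq(A),
     is_path_set P1 -> is_path_set P2 -> is_path_set (P1 `&` P2)) /\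
  (forall P1 P2 : set 'Seq(A),
     is_path_set P1 -> is_path_set P2 -> is_path_set (P1 `|` P2)).
Proof.
split; [exact: closed_path_set | split; [exact: is_path_setI | exact: is_path_setU]].
Qed.
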